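(* Let $\zeta_5=e^{2\pi i/5}$ and write $c_k=\theta[\tfrac15;\tfrac k5]$, $d_k=\theta[\tfrac35;\tfrac k5]$ for $k\in\{1,3,5,7,9\}$ (theta constants, functions of $\tau$). For every $\tau\in\mathbb{H}^2$: $$(c_1^2c_3-\zeta_5^4c_9^2c_7)(\zeta_5d_7^2d_1-\zeta_5d_3^2d_9)=(d_1^2d_3-\zeta_5^2d_9^2d_7)(\zeta_5^2c_7^2c_1-\zeta_5^2c_3^2c_9),$$ $$(\zeta_5^2c_5^2c_7+c_3^2c_1)(d_1^2d_5+\zeta_5d_7^2d_3)=(\zeta_5d_5^2d_7+d_3^2d_1)(c_1^2c_5+\zeta_5^2c_7^2c_3),$$ $$(\zeta_5^2c_7^2c_5-\zeta_5^2c_9^2c_1)(d_1^2d_7+\zeta_5d_5^2d_9)=(\zeta_5d_7^2d_5-\zeta_5d_9^2d_1)(c_1^2c_7+\zeta_5^2c_5^2c_9),$$ $$(-c_1^2c_9+c_3^2c_5)(\zeta_5d_9^2d_3+d_5^2d_1)=(-d_1^2d_9+d_3^2d_5)(\zeta_5^2c_9^2c_3+c_5^2c_1),$$ $$(\zeta_5^2c_7^2c_9+c_5^2c_3)(d_3^2d_7+\zeta_5d_9^2d_5)=(\zeta_5d_7^2d_9+d_5^2d_3)(c_3^2c_7+\zeta_5^2c_9^2c_5).$$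
   Context: Let $\mathbb{H}^2=\{\tau\in\mathbb{C}:\Im\tau>0\}$. For $(\epsilon,\epsilon')\in\mathbb{R}^2$, $$\theta[\epsilon;\epsilon'](\zeta,\tau)=\sum_{n\in\mathbb{Z}}\exp\Big(2\pi i\Big[\tfrac12\big(n+\tfrac{\epsilon}{2}\big)^2\tau+\big(n+\tfrac{\epsilon}{2}\big)\big(\zeta+\tfrac{\epsilon'}{2}\big)\Big]\Big),$$ and $\theta[\epsilon;\epsilon']=\theta[\epsilon;\epsilon'](0,\tau)$ denotes the theta constant. *)

(* Defs.v *)
From Stdlib Require Import Reals ZArith.
From Coquelicot Require Import Coquelicot.
Open Scope C_scope.

Definition Cexp (z : C) : C :=
  (exp (Re z) * cos (Im z), exp (Re z) * sin (Im z))%R.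

(* Sum over Z of a complex family, as the sum over n >= 0 plus the sum over
   n <= -1, each taken componentwise (real and imaginary parts) with
   Coquelicot's Series.  For the theta series (Im tau > 0) everything
   converges absolutely, so this is the usual value of the bilateral sum. *)
Definition Zsum (f : Z -> C) : C :=
  ((Series (fun k => Re (f (Z.of_nat k))) +
    Series (fun k => Re (f (- Z.of_nat k - 1)%Z)))%R,
   (Series (fun k => Im (f (Z.of_nat k))) +
    Series (fun k => Im (f (- Z.of_nat k - 1)%Z)))%R).

Definition theta (eps eps' : R) (zeta tau : C) : C :=
  Zsum (fun n =>
    let m : C := RtoC (IZR n + eps / 2) in
    Cexp (2 * RtoC PI * Ci * (/ 2 * m ^ 2 * tau + m * (zeta + RtoC (eps' / 2))))).

Definition theta_const (eps eps' : R) (tau : C) : C := theta eps eps' 0 tau.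

Definition zeta5 : C := Cexp (2 * RtoC PI * Ci / 5).

Definition cth (k : nat) (tau : C) : C := theta_const (1/5) (INR k / 5) tau.
Definition dth (k : nat) (tau : C) : C := theta_const (3/5) (INR k / 5) tau.

(* Main.v *)
Require Import Defs.
From Stdlib Require Import Reals ZArith List FinFun Lia Lra Classical.
From Coquelicot Require Import Coquelicot.
Import ListNotations.
Open Scope C_scope.

(** Write [S_p(x)] for the sum over [n] of [e(1/2 (n+p)^2 tau + (n+p) x)], so that
    [c_k = S_{1/10}(k/10)] and [d_k = S_{3/10}(k/10)], and put
    [F(p,b,a) = S_p(b+a)^2 S_p(b-2a) - S_p(b-a)^2 S_p(b+2a)].
    Expanding a product [S_p(b+a)^2 S_p(b-2a)] as a triple sum and grouping the terms
    by [N = n_1 + n_2 + n_3] gives the sum over [N] of [E_{p,b}(N) K_N(a)], where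
    [K_N(a)] depends only on [N] mod 3 and [K_N(-a) = K_{-N}(a)].  Hence
    [K_N(a) - K_N(-a)] is [K_1(a) - K_{-1}(a)] times the nontrivial character mod 3,
    and [F(p,b,a)] is the product of a function of [a] and a function of [(p,b)].
    Up to roots of unity coming from [S_p(x+1) = e(p) S_p(x)], the five identities are
    [F(1/10,b,-2/5) F(3/10,b,1/5) = F(3/10,b,-2/5) F(1/10,b,1/5)] for
    [b = 5/10, 9/10, 3/10, 7/10, 1/10]. *)

(** * Unordered sums of complex families *)

Definition lsum {I : Type} (f : I -> C) (L : list I) : C :=
  fold_right (fun i s => f i + s) 0 L.

Definition rsum {I : Type} (f : I -> R) (L : list I) : R :=
  fold_right (fun i s => (f i + s)%R) 0%R L.

(** Convergence along the net of finite subsets, encoded as repetition-free lists. No order on [I]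
    is involved, so bijective reindexing and regrouping by fibres become available for any index
    type. *)
Definition has_sum {I : Type} (f : I -> C) (s : C) : Prop :=
  forall eps : R, (0 < eps)%R -> exists L0 : list I,
  forall L, NoDup L -> incl L0 L -> (Cmod (lsum f L - s) < eps)%R.

Definition summable {I : Type} (f : I -> C) : Prop :=
  exists B : R, forall L, NoDup L -> (rsum (fun i => Cmod (f i)) L <= B)%R.

(** Excluded middle replaces decidable equality, as the index types are arbitrary. *)
Lemma exists_nodup {I : Type} (L : list I) :
  exists L', NoDup L' /\ forall x, In x L' <-> In x L.
Proof.
  induction L as [|a L [L' [HN HI]]].
  - exists []; split; [constructor | tauto].
  - destruct (classic (In a L)) as [Ha|Ha].
    + exists L'; split; [exact HN|]. intros x; rewrite HI; simpl.
      intuition congruence.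
    + exists (a :: L'); split.
      * constructor; [now rewrite HI | exact HN].
      * intros x; simpl; rewrite HI; tauto.
Qed.

Lemma lsum_app {I : Type} (f : I -> C) (L1 L2 : list I) :
  lsum f (L1 ++ L2) = lsum f L1 + lsum f L2.
Proof. induction L1 as [|a L1 IH]; simpl; [|rewrite IH]; ring. Qed.

Lemma lsum_map {I J : Type} (f : I -> C) (h : J -> I) (L : list J) :
  lsum f (map h L) = lsum (fun j => f (h j)) L.
Proof. induction L as [|a L IH]; simpl; congruence. Qed.

Lemma lsum_ext {I : Type} (f g : I -> C) (L : list I) :
  (forall i, f i = g i) -> lsum f L = lsum g L.
Proof. intros H; induction L as [|a L IH]; simpl; congruence. Qed.

Lemma lsum_plus {I : Type} (f g : I -> C) (L : list I) :
  lsum (fun i => f i + g i) L = lsum f L + lsum g L.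
Proof. induction L as [|a L IH]; simpl; [|rewrite IH]; ring. Qed.

Lemma lsum_scal {I : Type} (c : C) (f : I -> C) (L : list I) :
  lsum (fun i => c * f i) L = c * lsum f L.
Proof. induction L as [|a L IH]; simpl; [|rewrite IH]; ring. Qed.

Lemma lsum_RtoC {I : Type} (g : I -> R) (L : list I) :
  lsum (fun i => RtoC (g i)) L = RtoC (rsum g L).
Proof.
  induction L as [|a L IH]; simpl; [reflexivity|].
  now rewrite IH, RtoC_plus.
Qed.

Lemma rsum_app {I : Type} (f : I -> R) (L1 L2 : list I) :
  rsum f (L1 ++ L2) = (rsum f L1 + rsum f L2)%R.
Proof. induction L1 as [|a L1 IH]; simpl; [|rewrite IH]; ring. Qed.

Lemma rsum_map {I J : Type} (f : I -> R) (h : J -> I) (L : list J) :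
  rsum f (map h L) = rsum (fun j => f (h j)) L.
Proof. induction L as [|a L IH]; simpl; congruence. Qed.

Lemma rsum_scal {I : Type} (c : R) (f : I -> R) (L : list I) :
  rsum (fun i => (c * f i)%R) L = (c * rsum f L)%R.
Proof. induction L as [|a L IH]; simpl; [|rewrite IH]; ring. Qed.

Lemma rsum_le {I : Type} (f g : I -> R) (L : list I) :
  (forall i, f i <= g i)%R -> (rsum f L <= rsum g L)%R.
Proof.
  intros H; induction L as [|a L IH]; simpl; [lra|].
  specialize (H a); lra.
Qed.

Lemma rsum_nonneg {I : Type} (f : I -> R) (L : list I) :
  (forall i, 0 <= f i)%R -> (0 <= rsum f L)%R.
Proof.
  intros H; induction L as [|a L IH]; simpl; [lra|].
  specialize (H a); lra.
Qed.

Lemma rsum_incl {I : Type} (f : I -> R) (L L' : list I) :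
  (forall i, 0 <= f i)%R -> NoDup L -> incl L L' ->
  (rsum f L <= rsum f L')%R.
Proof.
  intros Hf HN; revert L'; induction HN as [|a L Ha HN IH]; intros L' HI.
  - now apply rsum_nonneg.
  - destruct (in_split a L') as [l1 [l2 E]]; [apply HI; now left|]. subst L'.
    assert (H : incl L (l1 ++ l2)).
    { intros x Hx. assert (Hx' := HI x (or_intror Hx)).
      apply in_app_iff in Hx'; apply in_app_iff; simpl in Hx'.
      destruct Hx' as [?|[?|?]]; [tauto| |tauto]. subst; contradiction. }
    specialize (IH _ H). rewrite rsum_app in *; simpl; lra.
Qed.

Lemma rsum_list_prod {I J : Type} (f : I -> R) (g : J -> R) A B :
  rsum (fun x => (f (fst x) * g (snd x))%R) (list_prod A B) =
  (rsum f A * rsum g B)%R.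
Proof.
  induction A as [|a A IH]; simpl; [ring|].
  rewrite rsum_app, IH, rsum_map; simpl. rewrite rsum_scal. ring.
Qed.

Lemma has_sum_ext {I : Type} (f g : I -> C) (s : C) :
  (forall i, f i = g i) -> has_sum f s -> has_sum g s.
Proof.
  intros E H eps He. destruct (H eps He) as [L0 HL]. exists L0; intros L H1 H2.
  rewrite <- (lsum_ext f g L E). now apply HL.
Qed.

Lemma has_sum_unique {I : Type} (f : I -> C) (s t : C) :
  has_sum f s -> has_sum f t -> s = t.
Proof.
  intros Hs Ht. destruct (Req_dec (Cmod (s - t)) 0) as [E|E].
  - apply Cmod_eq_0 in E. replace s with (s - t + t) by ring. rewrite E; ring.
  - exfalso. assert (P : (0 < Cmod (s - t) / 2)%R)
      by (generalize (Cmod_ge_0 (s - t)); lra).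
    destruct (Hs _ P) as [L1 H1], (Ht _ P) as [L2 H2].
    destruct (exists_nodup (L1 ++ L2)) as [L [HN HI]].
    specialize (H1 L HN); specialize (H2 L HN).
    assert (K1 := H1 (fun x Hx => proj2 (HI x) (in_or_app _ _ _ (or_introl Hx)))).
    assert (K2 := H2 (fun x Hx => proj2 (HI x) (in_or_app _ _ _ (or_intror Hx)))).
    assert (T := Cmod_triangle (- (lsum f L - s)) (lsum f L - t)).
    rewrite Cmod_opp in T.
    replace (- (lsum f L - s) + (lsum f L - t)) with (s - t) in T by ring. lra.
Qed.

Lemma has_sum_plus {I : Type} (f g : I -> C) (s t : C) :
  has_sum f s -> has_sum g t -> has_sum (fun i => f i + g i) (s + t).
Proof.
  intros Hs Ht eps He.
  destruct (Hs (eps / 2)%R) as [L1 H1]; [lra|].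
  destruct (Ht (eps / 2)%R) as [L2 H2]; [lra|].
  exists (L1 ++ L2); intros L HN HI. apply incl_app_inv in HI as [I1 I2].
  specialize (H1 L HN I1); specialize (H2 L HN I2). rewrite lsum_plus.
  replace (lsum f L + lsum g L - (s + t))
    with ((lsum f L - s) + (lsum g L - t)) by ring.
  eapply Rle_lt_trans; [apply Cmod_triangle | lra].
Qed.

Lemma has_sum_scal {I : Type} (c : C) (f : I -> C) (s : C) :
  has_sum f s -> has_sum (fun i => c * f i) (c * s).
Proof.
  intros Hs eps He. assert (Hc := Cmod_ge_0 c).
  destruct (Hs (eps / (Cmod c + 1))%R) as [L0 H0];
    [apply Rdiv_lt_0_compat; lra|].
  exists L0; intros L HN HI. specialize (H0 L HN HI). rewrite lsum_scal.
  replace (c * lsum f L - c * s) with (c * (lsum f L - s)) by ring.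
  rewrite Cmod_mult. assert (Hm := Cmod_ge_0 (lsum f L - s)).
  apply (Rmult_lt_compat_r (Cmod c + 1)) in H0; [|lra].
  unfold Rdiv in H0. rewrite Rmult_assoc, Rinv_l, Rmult_1_r in H0; nra.
Qed.

Lemma has_sum_minus {I : Type} (f g : I -> C) (s t : C) :
  has_sum f s -> has_sum g t -> has_sum (fun i => f i - g i) (s - t).
Proof.
  intros Hs Ht. replace (s - t) with (s + (-1) * t) by ring.
  apply has_sum_ext with (fun i => f i + (-1) * g i); [intros; ring|].
  apply has_sum_plus; [exact Hs | now apply has_sum_scal].
Qed.

Lemma has_sum_reindex {I J : Type} (h : J -> I) (k : I -> J) (f : I -> C) s :
  (forall j, k (h j) = j) -> (forall i, h (k i) = i) ->
  has_sum f s -> has_sum (fun j => f (h j)) s.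
Proof.
  intros kh hk Hs eps He. destruct (Hs eps He) as [L0 H0].
  exists (map k L0); intros L HN HI. rewrite <- lsum_map. apply H0.
  - apply Injective_map_NoDup; [|exact HN].
    intros x y E. rewrite <- (kh x), <- (kh y). now f_equal.
  - intros x Hx. rewrite <- (hk x). apply in_map, HI, in_map, Hx.
Qed.

(** Finite core of Fubini: over each [i] in [L] a finite piece of the fibre is taken that contains
    [K] and sums to within [delta] of [g i]. Their union [M] contains the rectangle [L] times [K],
    and the errors add up over [L]. *)
Lemma fiberwise_approx {I J : Type} (f : I * J -> C) (g : I -> C)
    (K : list J) (delta : R) (L : list I) :
  (forall i, has_sum (fun j => f (i, j)) (g i)) -> (0 < delta)%R -> NoDup L ->
  exists M, NoDup M /\ (forall i j, In (i, j) M -> In i L) /\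
    (forall i j, In i L -> In j K -> In (i, j) M) /\
    (Cmod (lsum f M - lsum g L) <= INR (length L) * delta)%R.
Proof.
  intros Hg Hd HN; induction HN as [|a L Ha HN [M [M1 [M2 [M3 M4]]]]].
  - exists []; split; [constructor|]. split; [intros ? ? []|].
    split; [intros ? ? []|].
    simpl. replace (0 - 0) with (RtoC 0) by ring. rewrite Cmod_0; lra.
  - destruct (Hg a delta Hd) as [L0 H0].
    destruct (exists_nodup (L0 ++ K)) as [K' [N' I']].
    assert (HK : incl L0 K').
    { intros x Hx. apply I', in_or_app; now left. }
    specialize (H0 K' N' HK).
    exists (map (pair a) K' ++ M). split; [|split; [|split]].
    + apply NoDup_app; [| exact M1 |].
      * apply Injective_map_NoDup; [|exact N'].
        intros x y E; congruence.
      * intros [i j] H1 H2. apply in_map_iff in H1 as [j' [E _]].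
        injection E as -> ->. now apply Ha, (M2 i j).
    + intros i j H; apply in_app_iff in H as [H|H].
      * apply in_map_iff in H as [j' [E _]]. left; congruence.
      * right; now apply (M2 i j).
    + intros i j [->|Hi] Hj; apply in_or_app.
      * left. apply in_map, I', in_or_app; now right.
      * right; now apply M3.
    + rewrite lsum_app, lsum_map.
      change (lsum g (a :: L)) with (g a + lsum g L).
      replace (lsum (fun j => f (a, j)) K' + lsum f M - (g a + lsum g L))
        with ((lsum (fun j => f (a, j)) K' - g a) + (lsum f M - lsum g L))
        by ring.
      eapply Rle_trans; [apply Cmod_triangle|].
      change (length (a :: L)) with (S (length L)). rewrite S_INR. lra.
Qed.

(** With [K] the second projection of [L0], the set [M] contains [L0], so the sum of [f] over [M] is
    close both to [s] and to the sum of [g] over [L]. *)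
Lemma has_sum_fubini {I J : Type} (f : I * J -> C) (g : I -> C) (s : C) :
  has_sum f s -> (forall i, has_sum (fun j => f (i, j)) (g i)) -> has_sum g s.
Proof.
  intros Hs Hg eps He. destruct (Hs (eps / 2)%R) as [L0 H0]; [lra|].
  exists (map fst L0); intros L HN HI.
  assert (Hl := pos_INR (length L)).
  (* The [+ 1] keeps the denominator positive for empty [L] and makes
     [INR (length L) * delta < eps / 2] strict. *)
  set (delta := (eps / 2 / (INR (length L) + 1))%R).
  assert (Hd : (0 < delta)%R) by (apply Rdiv_lt_0_compat; lra).
  destruct (fiberwise_approx f g (map snd L0) delta L Hg Hd HN)
    as [M [M1 [M2 [M3 M4]]]].
  assert (HM : incl L0 M).
  { intros [i j] Hx. apply M3; [apply HI|];
      apply in_map_iff; now exists (i, j). }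
  specialize (H0 M M1 HM).
  assert (E : (INR (length L) * delta < eps / 2)%R).
  { assert (delta * (INR (length L) + 1) = eps / 2)%R
      by (unfold delta; field; lra). lra. }
  replace (lsum g L - s) with (- (lsum f M - lsum g L) + (lsum f M - s)) by ring.
  eapply Rle_lt_trans; [apply Cmod_triangle|]. rewrite Cmod_opp. lra.
Qed.

(** * Absolute summability *)

Lemma summable_le {I : Type} (f g : I -> C) :
  (forall i, Cmod (f i) <= Cmod (g i))%R -> summable g -> summable f.
Proof.
  intros H [B HB]; exists B; intros L HN.
  eapply Rle_trans; [apply rsum_le, H | now apply HB].
Qed.

Lemma summable_scal {I : Type} (c : C) (f : I -> C) :
  summable f -> summable (fun i => c * f i).
Proof.
  intros [B HB]; exists (Cmod c * B)%R; intros L HN.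
  apply Rle_trans with (rsum (fun i => (Cmod c * Cmod (f i))%R) L).
  - apply rsum_le; intros; rewrite Cmod_mult; lra.
  - rewrite rsum_scal. apply Rmult_le_compat_l; [apply Cmod_ge_0 | now apply HB].
Qed.

Lemma summable_comp {I J : Type} (h : J -> I) (f : I -> C) :
  (forall x y, h x = h y -> x = y) -> summable f ->
  summable (fun j => f (h j)).
Proof.
  intros Hh [B HB]; exists B; intros L HN.
  rewrite <- (rsum_map (fun i => Cmod (f i)) h). apply HB.
  now apply Injective_map_NoDup.
Qed.

(** A finite set of pairs lies in the product of its two projections, where the sum of moduli
    factors. *)
Lemma summable_prod {I J : Type} (f : I -> C) (g : J -> C) :
  summable f -> summable g -> summable (fun x => f (fst x) * g (snd x)).
Proof.
  intros [A HA] [B HB]; exists (A * B)%R; intros L HN.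
  destruct (exists_nodup (map fst L)) as [L1 [N1 I1]].
  destruct (exists_nodup (map snd L)) as [L2 [N2 I2]].
  eapply Rle_trans.
  - apply rsum_incl with (L' := list_prod L1 L2);
      [intros; apply Cmod_ge_0 | exact HN |].
    intros [i j] Hx. apply in_prod; [apply I1 | apply I2];
      apply in_map_iff; now exists (i, j).
  - eapply Rle_trans.
    + apply rsum_le with (g := fun x => (Cmod (f (fst x)) * Cmod (g (snd x)))%R).
      intros; rewrite Cmod_mult; lra.
    + rewrite (rsum_list_prod (fun i => Cmod (f i)) (fun j => Cmod (g j))).
      apply Rmult_le_compat; try (apply rsum_nonneg; intros; apply Cmod_ge_0);
        auto.
Qed.

Lemma has_sum_nonneg {I : Type} (g : I -> R) (B : R) :
  (forall i, 0 <= g i)%R -> (forall L, NoDup L -> rsum g L <= B)%R ->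
  exists s : C, has_sum (fun i => RtoC (g i)) s.
Proof.
  intros Hg HB.
  (* The sum is the supremum of the finite partial sums; since these grow with the index set, one
     list within [eps] of the supremum serves as [L0]. *)
  destruct (completeness (fun x => exists L, NoDup L /\ x = rsum g L))
    as [S [HS1 HS2]].
  - exists B. intros x [L [HN ->]]. now apply HB.
  - exists 0%R, []. split; [constructor | reflexivity].
  - exists (RtoC S). intros eps He.
    destruct (classic (exists L, NoDup L /\ (S - eps < rsum g L)%R))
      as [[L0 [N0 H0]]|H].
    + exists L0; intros L HN HI. rewrite lsum_RtoC, <- RtoC_minus, Cmod_R.
      assert (H1 := rsum_incl g L0 L Hg N0 HI).
      assert (H2 : (rsum g L <= S)%R) by (apply HS1; now exists L).
      apply Rabs_def1; lra.
    + exfalso. assert (S <= S - eps)%R; [|lra].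
      apply HS2. intros x [L [HN ->]].
      destruct (Rle_lt_dec (rsum g L) (S - eps)); [assumption|].
      exfalso; apply H; now exists L.
Qed.

Lemma summable_has_sum {I : Type} (f : I -> C) :
  summable f -> exists s, has_sum f s.
Proof.
  intros [B HB].
  assert (Hre : forall i, (Rabs (fst (f i)) <= Cmod (f i))%R).
  { intros i. eapply Rle_trans; [apply Rmax_l | apply Rmax_Cmod]. }
  assert (Him : forall i, (Rabs (snd (f i)) <= Cmod (f i))%R).
  { intros i. eapply Rle_trans; [apply Rmax_r | apply Rmax_Cmod]. }
  destruct (has_sum_nonneg (fun i => Cmod (f i)) B) as [s0 H0];
    [intros; apply Cmod_ge_0 | exact HB |].
  (* A real family [u] dominated by [|f|] is the difference of the nonnegative families [|f| + u]
     and [|f|], both with bounded partial sums. This is then applied to the real and imaginary parts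
     of [f]. *)
  assert (H : forall u : I -> R, (forall i, Rabs (u i) <= Cmod (f i))%R ->
    exists s : C, has_sum (fun i => RtoC (u i)) s).
  { intros u Hu.
    destruct (has_sum_nonneg (fun i => (Cmod (f i) + u i)%R) (2 * B)) as [s H].
    - intros i. specialize (Hu i). apply Rabs_le_between in Hu. lra.
    - intros L HN. specialize (HB L HN).
      apply Rle_trans with (rsum (fun i => (2 * Cmod (f i))%R) L).
      + apply rsum_le; intros i. specialize (Hu i).
        apply Rabs_le_between in Hu. lra.
      + rewrite rsum_scal. lra.
    - exists (s - s0).
      apply has_sum_ext with (fun i => RtoC (Cmod (f i) + u i) - RtoC (Cmod (f i))).
      + intros i. rewrite RtoC_plus. ring.
      + now apply has_sum_minus. }
  destruct (H (fun i => fst (f i)) Hre) as [s1 H1].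
  destruct (H (fun i => snd (f i)) Him) as [s2 H2].
  exists (s1 + Ci * s2).
  apply has_sum_ext with (fun i => RtoC (fst (f i)) + Ci * RtoC (snd (f i))).
  - intros i. destruct (f i) as [x y]. unfold RtoC, Ci, Cmult, Cplus; simpl.
    f_equal; ring.
  - apply has_sum_plus; [exact H1 | now apply has_sum_scal].
Qed.

(** Summability gives some total [u]; Fubini with fibre sums [f i * t] identifies it as [s * t]. *)
Lemma has_sum_prod {I J : Type} (f : I -> C) (g : J -> C) (s t : C) :
  summable f -> summable g -> has_sum f s -> has_sum g t ->
  has_sum (fun x => f (fst x) * g (snd x)) (s * t).
Proof.
  intros Sf Sg Hf Hg.
  destruct (summable_has_sum _ (summable_prod f g Sf Sg)) as [u Hu].
  replace (s * t) with u; [exact Hu|].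
  apply has_sum_unique with (fun i => f i * t).
  - apply has_sum_fubini with (fun x => f (fst x) * g (snd x)); [exact Hu|].
    intros i; simpl. now apply has_sum_scal.
  - rewrite Cmult_comm. apply has_sum_ext with (fun i => t * f i).
    + intros; ring.
    + now apply has_sum_scal.
Qed.

(** * Bilateral series *)

Lemma lsum_seq_sum_n (u : nat -> C) (n : nat) :
  lsum u (seq 0 (S n)) =
  (sum_n (fun k => Re (u k)) n, sum_n (fun k => Im (u k)) n).
Proof.
  induction n as [|n IH].
  - simpl. rewrite !sum_O. destruct (u 0%nat); unfold Cplus, RtoC; simpl.
    f_equal; ring.
  - rewrite seq_S, lsum_app, IH, !sum_Sn. simpl. unfold plus; simpl.
    destruct (u (S n)); unfold Cplus, RtoC; simpl. f_equal; ring.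
Qed.

(** Initial segments of the naturals eventually contain any given finite list, so the unordered sum
    is also the limit of ordered partial sums. *)
Lemma has_sum_nat_Series (u : nat -> C) (s : C) :
  has_sum u s ->
  Series (fun k => Re (u k)) = Re s /\ Series (fun k => Im (u k)) = Im s.
Proof.
  intros H.
  assert (K : forall eps : R, (0 < eps)%R -> exists N, forall n, (N <= n)%nat ->
     (Rabs (sum_n (fun k => Re (u k)) n - Re s) < eps)%R /\
     (Rabs (sum_n (fun k => Im (u k)) n - Im s) < eps)%R).
  { intros eps He. destruct (H eps He) as [L0 H0].
    exists (list_max L0). intros n Hn.
    assert (HI : incl L0 (seq 0 (S n))).
    { intros x Hx. apply in_seq.
      assert (Hm := proj1 (list_max_le L0 (list_max L0)) (le_n _)).
      rewrite Forall_forall in Hm. specialize (Hm x Hx). lia. }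
    specialize (H0 _ (seq_NoDup _ _) HI). rewrite lsum_seq_sum_n in H0.
    assert (T := Rmax_Cmod ((sum_n (fun k => Re (u k)) n,
                    sum_n (fun k => Im (u k)) n) - s)).
    destruct s as [s1 s2]; simpl in T, H0 |- *.
    assert (T1 := Rmax_l (Rabs (sum_n (fun k => Re (u k)) n + - s1))
                         (Rabs (sum_n (fun k => Im (u k)) n + - s2))).
    assert (T2 := Rmax_r (Rabs (sum_n (fun k => Re (u k)) n + - s1))
                         (Rabs (sum_n (fun k => Im (u k)) n + - s2))).
    unfold Rminus. split; lra. }
  split; apply is_series_unique.
  - change (is_lim_seq (sum_n (fun k => Re (u k))) (Re s)).
    apply is_lim_seq_spec; intros [eps He].
    destruct (K eps He) as [N HN]; exists N; intros n Hn; now apply HN.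
  - change (is_lim_seq (sum_n (fun k => Im (u k))) (Im s)).
    apply is_lim_seq_spec; intros [eps He].
    destruct (K eps He) as [N HN]; exists N; intros n Hn; now apply HN.
Qed.

(** Bijection of two copies of the naturals with the integers, matching the two halves in [Zsum]. *)
Definition Z_of_half (x : bool * nat) : Z :=
  if fst x then Z.of_nat (snd x) else (- Z.of_nat (snd x) - 1)%Z.

Definition half_of_Z (n : Z) : bool * nat :=
  if (0 <=? n)%Z then (true, Z.to_nat n) else (false, Z.to_nat (- n - 1)).

Lemma half_of_ZK n : Z_of_half (half_of_Z n) = n.
Proof.
  unfold half_of_Z, Z_of_half. destruct (Z.leb_spec 0 n); simpl; lia.
Qed.

Lemma Z_of_halfK x : half_of_Z (Z_of_half x) = x.
Proof.
  destruct x as [[|] k]; unfold half_of_Z, Z_of_half; simpl.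
  - destruct (Z.leb_spec 0 (Z.of_nat k)); [|lia]. f_equal; lia.
  - destruct (Z.leb_spec 0 (- Z.of_nat k - 1)); [lia|]. f_equal; lia.
Qed.

Lemma has_sum_bool (g : bool -> C) : has_sum g (g true + g false).
Proof.
  intros eps He. exists [true; false]. intros L HN HI.
  assert (E : lsum g L = g true + g false).
  { assert (Ht := HI true (or_introl eq_refl)).
    assert (Hf := HI false (or_intror (or_introl eq_refl))).
    assert (Hl := NoDup_incl_length HN (l' := [true; false])).
    assert (length L <= 2)%nat.
    { apply Hl. intros [|] _; simpl; tauto. }
    destruct L as [|a [|b [|c L]]]; simpl in *.
    - contradiction.
    - destruct a; intuition congruence.
    - destruct a, b; try (intuition congruence); ring.
    - lia. }
  rewrite E. replace (g true + g false - (g true + g false)) with (RtoC 0) by ring.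
  now rewrite Cmod_0.
Qed.

(** Fubini over [bool] splits the unordered sum into the two half-line sums, which are the series in
    [Zsum]. *)
Lemma has_sum_Zsum (f : Z -> C) : summable f -> has_sum f (Zsum f).
Proof.
  intros Sf. destruct (summable_has_sum f Sf) as [s Hs].
  replace (Zsum f) with s; [exact Hs|].
  assert (inj : forall x y, Z_of_half x = Z_of_half y -> x = y).
  { intros x y E. rewrite <- (Z_of_halfK x), <- (Z_of_halfK y). now f_equal. }
  assert (Hb : forall b : bool, exists t,
     has_sum (fun k => f (Z_of_half (b, k))) t).
  { intros b. apply summable_has_sum.
    apply (summable_comp (fun k => Z_of_half (b, k))); [|exact Sf].
    intros x y E. apply inj in E. congruence. }
  destruct (Hb true) as [s1 H1], (Hb false) as [s2 H2].
  assert (E : s = s1 + s2).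
  { apply (has_sum_unique (fun b : bool => if b then s1 else s2));
      [|apply has_sum_bool].
    apply has_sum_fubini with (fun x => f (Z_of_half x)).
    - now apply (has_sum_reindex Z_of_half half_of_Z _ _ Z_of_halfK half_of_ZK).
    - intros [|]; assumption. }
  apply has_sum_nat_Series in H1 as [R1 I1].
  apply has_sum_nat_Series in H2 as [R2 I2].
  unfold Z_of_half in R1, R2, I1, I2; simpl in R1, R2, I1, I2.
  unfold Zsum. rewrite R1, R2, I1, I2, E. now destruct s1, s2.
Qed.

Lemma summable_nat_geometric (r : R) :
  (0 <= r < 1)%R -> summable (fun k : nat => RtoC (r ^ k)%R).
Proof.
  intros [r0 r1]. exists (/ (1 - r))%R. intros L HN.
  apply Rle_trans with (rsum (fun k => (r ^ k)%R) (seq 0 (S (list_max L)))).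
  - eapply Rle_trans.
    + apply rsum_incl with (L' := seq 0 (S (list_max L)));
        [intros; apply Cmod_ge_0 | exact HN |].
      intros x Hx. apply in_seq.
      assert (Hm := proj1 (list_max_le L (list_max L)) (le_n _)).
      rewrite Forall_forall in Hm. specialize (Hm x Hx). lia.
    + apply rsum_le. intros k. rewrite Cmod_R, Rabs_pos_eq; [lra|].
      now apply pow_le.
  - assert (G : forall n,
      (rsum (fun k => (r ^ k)%R) (seq 0 n) = (1 - r ^ n) / (1 - r))%R).
    { induction n as [|n IH]; [simpl; field; lra|].
      rewrite seq_S, rsum_app, IH. simpl. field; lra. }
    rewrite G. unfold Rdiv. rewrite <- (Rmult_1_l (/ (1 - r))) at 2.
    apply Rmult_le_compat_r.
    + apply Rlt_le, Rinv_0_lt_compat; lra.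
    + assert (0 <= r ^ S (list_max L))%R by now apply pow_le. lra.
Qed.

Lemma summable_Z_geometric (r : R) :
  (0 <= r < 1)%R -> summable (fun n : Z => RtoC (r ^ Z.abs_nat n)%R).
Proof.
  intros Hr.
  assert (Sb : summable (fun _ : bool => RtoC 1)).
  { exists 2%R. intros L HN.
    apply Rle_trans with (rsum (fun _ : bool => 1%R) [true; false]); [|simpl; lra].
    eapply Rle_trans;
      [|apply rsum_incl with (L := L); [intros; lra | exact HN |]].
    - apply rsum_le; intros; rewrite Cmod_1; lra.
    - intros [|] _; simpl; tauto. }
  assert (S2 := summable_prod _ _ Sb (summable_nat_geometric r Hr)).
  apply (summable_comp half_of_Z) in S2.
  2:{ intros x y E. rewrite <- (half_of_ZK x), <- (half_of_ZK y). now f_equal. }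
  apply (summable_le _ _) with (2 := S2). intros n.
  rewrite Cmult_1_l, !Cmod_R, !Rabs_pos_eq by (apply pow_le; lra).
  unfold half_of_Z. destruct (Z.leb_spec 0 n); simpl.
  - rewrite Zabs2Nat.abs_nat_nonneg by assumption. lra.
  (* On the negative half [|n| = k + 1]; the extra factor [r] only decreases the term. *)
  - replace (Z.abs_nat n) with (S (Z.to_nat (- n - 1))) by lia. simpl.
    assert (0 <= r ^ Z.to_nat (- n - 1))%R by (apply pow_le; lra). nra.
Qed.

(** * Gaussian exponentials and theta constants *)

Lemma Cexp_plus (u v : C) : Cexp (u + v) = Cexp u * Cexp v.
Proof.
  destruct u as [a b], v as [c d]. unfold Cexp, Cmult; simpl.
  rewrite exp_plus, cos_plus, sin_plus. f_equal; ring.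
Qed.

Lemma Cmod_Cexp (u : C) : Cmod (Cexp u) = exp (Re u).
Proof.
  destruct u as [a b]. unfold Cexp, Cmod; simpl.
  transitivity (sqrt (Rsqr (exp a))); [|apply sqrt_Rsqr, Rlt_le, exp_pos].
  f_equal.
  assert (H := sin2_cos2 b). unfold Rsqr in *.
  transitivity (exp a * exp a * (sin b * sin b + cos b * cos b))%R; [ring|].
  rewrite H; ring.
Qed.

(** Common shape of all terms below: multiplying terms adds the real coefficients [A] and [B], so
    identities between products reduce to real algebra. *)
Definition gauss (tau : C) (A B : R) : C :=
  Cexp (2 * RtoC PI * Ci * (/ 2 * RtoC A * tau + RtoC B)).

Lemma gauss_mult tau A B A' B' :
  gauss tau A B * gauss tau A' B' = gauss tau (A + A') (B + B').
Proof.
  unfold gauss. rewrite <- Cexp_plus, !RtoC_plus. f_equal. ring.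
Qed.

Lemma Cmod_gauss tau A B : Cmod (gauss tau A B) = exp (- (PI * Im tau * A)).
Proof.
  unfold gauss. rewrite Cmod_Cexp. f_equal. destruct tau as [x y].
  unfold Re, Im, Ci, Cinv, Cmult, Cplus, RtoC; simpl. field.
Qed.

Lemma gauss_neq_0 tau A B : gauss tau A B <> 0.
Proof. apply Cmod_gt_0. rewrite Cmod_gauss. apply exp_pos. Qed.

Definition theta_term (tau : C) (p x : R) (n : Z) : C :=
  gauss tau ((IZR n + p) ^ 2) ((IZR n + p) * x).

Lemma theta_constE (eps eps' : R) (tau : C) :
  theta_const eps eps' tau = Zsum (theta_term tau (eps / 2) (eps' / 2)).
Proof.
  assert (E : forall n : Z, Cexp (2 * RtoC PI * Ci *
      (/ 2 * RtoC (IZR n + eps / 2) ^ 2 * tau +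
       RtoC (IZR n + eps / 2) * (0 + RtoC (eps' / 2)))) =
    theta_term tau (eps / 2) (eps' / 2) n).
  { intros n. unfold theta_term, gauss.
    rewrite RtoC_pow, (RtoC_mult _ (eps' / 2)). f_equal. ring. }
  unfold theta_const, theta, Zsum; cbv zeta.
  f_equal; f_equal; apply Series_ext; intros k; now rewrite E.
Qed.

(** Combines [t^2 >= |t| - 1/4], from [(|t| - 1/2)^2 >= 0], with [|n + p| >= |n| - |p|]. A linear
    bound suffices for comparison with a geometric family. *)
Lemma sqr_shift_ge (p : R) (n : Z) :
  (INR (Z.abs_nat n) - Rabs p - / 4 <= (IZR n + p) ^ 2)%R.
Proof.
  rewrite INR_IZR_INZ, Zabs2Nat.id_abs, abs_IZR.
  assert (H := Rabs_triang (IZR n + p) (- p)).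
  replace (IZR n + p + - p)%R with (IZR n) in H by ring.
  rewrite Rabs_Ropp in H. rewrite <- (pow2_abs (IZR n + p)).
  assert (H2 := pow2_ge_0 (Rabs (IZR n + p) - / 2)). nra.
Qed.

(** The modulus [exp (- PI * Im tau * (n + p)^2)] is dominated by a constant times a geometric
    family in [|n|] of ratio [exp (- PI * Im tau)]. *)
Lemma summable_theta_term (tau : C) (p x : R) :
  (0 < Im tau)%R -> summable (theta_term tau p x).
Proof.
  intros Ht. assert (Hc : (0 < PI * Im tau)%R)
    by (apply Rmult_lt_0_compat; [apply PI_RGT_0 | exact Ht]).
  set (c := (PI * Im tau)%R) in *.
  assert (Hr : (0 <= exp (- c) < 1)%R).
  { split; [apply Rlt_le, exp_pos|]. rewrite <- exp_0.
    apply exp_increasing. lra. }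
  apply (summable_le _ _) with
    (2 := summable_scal (RtoC (exp (c * (Rabs p + / 4)))) _
            (summable_Z_geometric _ Hr)).
  intros n. unfold theta_term.
  rewrite Cmod_gauss, Cmod_mult, !Cmod_R. fold c.
  rewrite (Rabs_pos_eq (exp _)) by apply Rlt_le, exp_pos.
  rewrite (Rabs_pos_eq (_ ^ _)) by (apply pow_le; lra).
  assert (X : forall k, (exp (- c) ^ k = exp (- c * INR k))%R).
  { intros k. rewrite <- Rpower_pow by apply exp_pos. unfold Rpower.
    rewrite ln_exp. f_equal; ring. }
  rewrite X, <- exp_plus.
  assert (H := sqr_shift_ge p n).
  assert (- (c * (IZR n + p) ^ 2) <=
    c * (Rabs p + / 4) + - c * INR (Z.abs_nat n))%R as [K|K] by nra.
  - now apply Rlt_le, exp_increasing.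
  - rewrite K. lra.
Qed.

Lemma Zsum_has_sum_unique (f : Z -> C) (s : C) :
  summable f -> has_sum f s -> Zsum f = s.
Proof.
  intros Sf Hs. apply (has_sum_unique f); [now apply has_sum_Zsum | exact Hs].
Qed.

(** * Roots of unity and quasi-periodicity *)

Definition e1 (x : R) : C := Cexp (2 * RtoC PI * Ci * RtoC x).

Lemma e1_plus x y : e1 (x + y) = e1 x * e1 y.
Proof. unfold e1. rewrite <- Cexp_plus, RtoC_plus. f_equal; ring. Qed.

Lemma e1_eq x : e1 x = (cos (2 * PI * x), sin (2 * PI * x))%R.
Proof.
  unfold e1. transitivity (Cexp (0, 2 * PI * x)%R).
  - f_equal. unfold Ci, Cmult, RtoC; simpl. f_equal; ring.
  - unfold Cexp; simpl. rewrite exp_0. f_equal; ring.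
Qed.

Lemma e1_IZR (n : Z) : e1 (IZR n) = 1.
Proof.
  rewrite e1_eq. unfold RtoC.
  replace (2 * PI * IZR n)%R with (IZR (2 * n) * PI)%R
    by (rewrite mult_IZR; ring).
  f_equal.
  - replace (IZR (2 * n) * PI)%R with (2 * (IZR n * PI))%R
      by (rewrite mult_IZR; ring).
    rewrite cos_2a_sin. rewrite (sin_eq_0_1 (IZR n * PI)) by now exists n. ring.
  - apply sin_eq_0_1. now exists (2 * n)%Z.
Qed.

Lemma e1_half : e1 (1 / 2) = -1.
Proof.
  rewrite e1_eq. replace (2 * PI * (1 / 2))%R with PI by field.
  rewrite cos_PI, sin_PI. unfold RtoC. reflexivity.
Qed.

Definition thsum (tau : C) (p x : R) : C := Zsum (theta_term tau p x).

Lemma thsum_shift (tau : C) (p x : R) : (0 < Im tau)%R ->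
  thsum tau p (x + 1) = e1 p * thsum tau p x.
Proof.
  intros Ht. apply Zsum_has_sum_unique; [now apply summable_theta_term|].
  apply has_sum_ext with (fun n => e1 p * theta_term tau p x n).
  - intros n. unfold theta_term, gauss.
    (* Shifting [x] by 1 multiplies the term by [e1 (n + p)]; the trivial factor [e1 n = 1] is
       inserted to match the exponents. *)
    rewrite <- (Cmult_1_l (_ * _)), <- (e1_IZR n), Cmult_assoc, <- e1_plus.
    unfold e1. rewrite <- Cexp_plus. f_equal.
    rewrite !RtoC_mult, !RtoC_plus. ring.
  - now apply has_sum_scal, has_sum_Zsum, summable_theta_term.
Qed.

(** * Products of three theta constants *)

Definition outer (tau : C) (p b : R) (N : Z) : C :=
  gauss tau (3 * (IZR N / 3 + p) ^ 2) ((IZR N / 3 + p) * (3 * b)).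

(** [u] and [v] are the deviations of two summation indices from their mean [N/3]; the third
    deviation is [-(u + v)]. Neither [p] nor [b] enters. *)
Definition inner (tau : C) (a : R) (N : Z) (m : Z * Z) : C :=
  let u := (IZR (fst m) - IZR N / 3)%R in
  let v := (IZR (snd m) - IZR N / 3)%R in
  gauss tau (u ^ 2 + v ^ 2 + (u + v) ^ 2) (3 * a * (u + v)).

Definition triple (tau : C) (p b a : R) (x : Z * (Z * Z)) : C :=
  theta_term tau p (b + a) (fst x) *
  (theta_term tau p (b + a) (fst (snd x)) *
   theta_term tau p (b - 2 * a) (snd (snd x))).

(* With [n_i + p = (N/3 + p) + m_i], where [N = n_1 + n_2 + n_3] and the [m_i] sum to [0],
   the quadratic form splits as [3 (N/3 + p)^2 + m_1^2 + m_2^2 + m_3^2]. *)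
Lemma triple_split tau p b a (N m n : Z) :
  triple tau p b a (m, (n, N - m - n)%Z) =
  outer tau p b N * inner tau a N (m, n).
Proof.
  unfold triple, outer, inner, theta_term; simpl fst; simpl snd; cbv zeta.
  rewrite !gauss_mult, !minus_IZR. f_equal; field.
Qed.

Lemma summable_triple tau p b a : (0 < Im tau)%R -> summable (triple tau p b a).
Proof.
  intros Ht. unfold triple.
  apply (summable_prod (theta_term tau p (b + a))
    (fun y => theta_term tau p (b + a) (fst y) *
              theta_term tau p (b - 2 * a) (snd y)));
    [|apply summable_prod]; now apply summable_theta_term.
Qed.

Lemma has_sum_triple tau p b a : (0 < Im tau)%R ->
  has_sum (triple tau p b a) (thsum tau p (b + a) ^ 2 * thsum tau p (b - 2 * a)).
Proof.
  intros Ht.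
  replace (thsum tau p (b + a) ^ 2 * thsum tau p (b - 2 * a)) with
    (thsum tau p (b + a) * (thsum tau p (b + a) * thsum tau p (b - 2 * a))) by ring.
  apply (has_sum_prod (theta_term tau p (b + a))
    (fun y => theta_term tau p (b + a) (fst y) *
              theta_term tau p (b - 2 * a) (snd y)));
    [| apply summable_prod | | apply has_sum_prod];
    solve [now apply summable_theta_term
          | now apply has_sum_Zsum, summable_theta_term].
Qed.

(** Up to the nonzero constant [outer tau 0 0 N], this family is the restriction of a summable
    triple family to one fibre; [p = b = 0] is an arbitrary choice. *)
Lemma summable_inner tau a N : (0 < Im tau)%R -> summable (inner tau a N).
Proof.
  intros Ht.
  apply (summable_le _ (fun y => / outer tau 0 0 N *
           triple tau 0 0 a (fst y, (snd y, N - fst y - snd y)%Z))).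
  - intros [m n]; simpl fst; simpl snd. rewrite triple_split.
    rewrite Cmult_assoc, Cinv_l, Cmult_1_l by apply gauss_neq_0. lra.
  - apply summable_scal.
    apply (summable_comp (fun y => (fst y, (snd y, N - fst y - snd y)%Z))).
    + intros [m n] [m' n'] E. simpl in E. congruence.
    + now apply summable_triple.
Qed.

(** Regroups the triple sum by the total [N] of the three indices; on each fibre [outer] is constant
    and factors out. *)
Lemma has_sum_outer tau p b a (K : Z -> C) : (0 < Im tau)%R ->
  (forall N, has_sum (inner tau a N) (K N)) ->
  has_sum (fun N => outer tau p b N * K N)
    (thsum tau p (b + a) ^ 2 * thsum tau p (b - 2 * a)).
Proof.
  intros Ht HK.
  apply has_sum_fubini with
    (fun x => triple tau p b a
       (fst (snd x), (snd (snd x), fst x - fst (snd x) - snd (snd x))%Z)).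
  - apply (has_sum_reindex
      (fun x => (fst (snd x), (snd (snd x), fst x - fst (snd x) - snd (snd x))%Z))
      (fun y => ((fst y + fst (snd y) + snd (snd y))%Z, (fst y, fst (snd y))))).
    + intros [N [m n]]; simpl. do 2 f_equal; lia.
    + intros [m [n k]]; simpl. do 2 f_equal; lia.
    + now apply has_sum_triple.
  - intros N. apply has_sum_ext with (fun y => outer tau p b N * inner tau a N y).
    + intros [m n]; simpl fst; simpl snd. now rewrite triple_split.
    + now apply has_sum_scal.
Qed.

(** Translating both indices by [q] absorbs the change of [N/3] by [q]. *)
Lemma has_sum_inner_shift tau a N q s :
  has_sum (inner tau a N) s -> has_sum (inner tau a (N + 3 * q)) s.
Proof.
  intros H. apply (has_sum_reindex
    (fun y : Z * Z => ((fst y - q)%Z, (snd y - q)%Z))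
    (fun y : Z * Z => ((fst y + q)%Z, (snd y + q)%Z))) in H.
  - revert H. apply has_sum_ext. intros [m n].
    unfold inner; simpl fst; simpl snd. cbv zeta.
    rewrite plus_IZR, mult_IZR, !minus_IZR. f_equal; field.
  - intros [m n]; simpl; f_equal; lia.
  - intros [m n]; simpl; f_equal; lia.
Qed.

Lemma inner_sum_periodic tau a : (0 < Im tau)%R ->
  exists K : Z -> C, (forall N, has_sum (inner tau a N) (K N)) /\
    forall N, K (N + 3)%Z = K N.
Proof.
  intros Ht.
  assert (H : forall r, exists s, has_sum (inner tau a r) s)
    by (intros r; now apply summable_has_sum, summable_inner).
  destruct (H 0%Z) as [k0 H0], (H 1%Z) as [k1 H1], (H 2%Z) as [k2 H2].
  (* Defining [K] through the residue makes it periodic by construction; the shift lemma transports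
     the sums from the representatives 0, 1, 2. *)
  exists (fun N => if (N mod 3 =? 0)%Z then k0
                   else if (N mod 3 =? 1)%Z then k1 else k2).
  split; intros N.
  - assert (D := Z.div_mod N 3 ltac:(lia)).
    assert (B := Z.mod_pos_bound N 3 ltac:(lia)).
    rewrite Z.add_comm in D. rewrite D at 1. apply has_sum_inner_shift.
    assert (N mod 3 = 0 \/ N mod 3 = 1 \/ N mod 3 = 2)%Z as [E|[E|E]] by lia;
      rewrite E; assumption.
  - replace ((N + 3) mod 3)%Z with (N mod 3)%Z; [reflexivity|].
    symmetry. apply (Z_mod_plus_full N 1 3).
Qed.

(** Negating [N] and both indices negates [u] and [v]: the quadratic part is even, and the sign of
    the linear part passes to [a]. *)
Lemma has_sum_inner_opp tau a N s :
  has_sum (inner tau a (- N)) s -> has_sum (inner tau (- a) N) s.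
Proof.
  intros H. apply (has_sum_reindex
    (fun y : Z * Z => ((- fst y)%Z, (- snd y)%Z))
    (fun y : Z * Z => ((- fst y)%Z, (- snd y)%Z))) in H.
  - revert H. apply has_sum_ext. intros [m n].
    unfold inner; simpl fst; simpl snd. cbv zeta.
    rewrite !opp_IZR. f_equal; field.
  - intros [m n]; simpl; f_equal; lia.
  - intros [m n]; simpl; f_equal; lia.
Qed.

(** * Antisymmetrisation in [a] and separation of variables *)

Definition theta_diff (tau : C) (p b a : R) : C :=
  thsum tau p (b + a) ^ 2 * thsum tau p (b - 2 * a) -
  thsum tau p (b - a) ^ 2 * thsum tau p (b + 2 * a).

Definition chi3 (N : Z) : C :=
  if (N mod 3 =? 0)%Z then 0 else if (N mod 3 =? 1)%Z then 1 else -1.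

(** Odd functions on the integers mod 3 form a line spanned by [chi3]: they vanish at 0, and 2 is
    [-1]. *)
Lemma odd_part_mod3 (K : Z -> C) : (forall N, K (N + 3)%Z = K N) ->
  forall N, K N - K (- N)%Z = chi3 N * (K 1%Z - K (- 1)%Z).
Proof.
  intros HK.
  assert (HP : forall q N, K (N + 3 * q)%Z = K N).
  { intros q. induction q as [|q IH|q IH] using Z.peano_ind; intros N.
    - f_equal; lia.
    - rewrite <- (IH N), <- (HK (N + 3 * q)%Z). f_equal; lia.
    - rewrite <- (IH N), <- (HK (N + 3 * Z.pred q)%Z). f_equal; lia. }
  intros N. unfold chi3.
  assert (D := Z.div_mod N 3 ltac:(lia)).
  assert (B := Z.mod_pos_bound N 3 ltac:(lia)).
  set (q := (N / 3)%Z) in *. set (r := (N mod 3)%Z) in *.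
  assert (E1 : K N = K r) by (rewrite D, Z.add_comm; apply HP).
  assert (E2 : K (- N)%Z = K (- r)%Z)
    by (rewrite <- (HP (- q)%Z (- r)%Z); f_equal; lia).
  rewrite E1, E2.
  assert (r = 0 \/ r = 1 \/ r = 2)%Z as [->|[->| ->]] by lia; simpl.
  - ring.
  - ring.
  - replace (K 2%Z) with (K (- 1)%Z) by (rewrite <- (HK (- 1)%Z); reflexivity).
    replace (K (- 2)%Z) with (K 1%Z) by (rewrite <- (HK (- 2)%Z); reflexivity).
    ring.
Qed.

(** The order of quantifiers is the point: [kappa] depends on [a] alone, while the remaining factor
    depends on [p] and [b] alone. *)
Lemma theta_diff_has_sum tau a : (0 < Im tau)%R ->
  exists kappa : C, forall p b,
    has_sum (fun N => kappa * (outer tau p b N * chi3 N)) (theta_diff tau p b a).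
Proof.
  intros Ht. destruct (inner_sum_periodic tau a Ht) as [K [HK PK]].
  exists (K 1%Z - K (- 1)%Z). intros p b.
  assert (HK' : forall N, has_sum (inner tau (- a) N) (K (- N)%Z))
    by (intros N; apply has_sum_inner_opp, HK).
  assert (H1 := has_sum_outer tau p b a K Ht HK).
  assert (H2 := has_sum_outer tau p b (- a) (fun N => K (- N)%Z) Ht HK').
  replace (b + - a)%R with (b - a)%R in H2 by ring.
  replace (b - 2 * - a)%R with (b + 2 * a)%R in H2 by ring.
  apply has_sum_ext with (2 := has_sum_minus _ _ _ _ H1 H2).
  intros N. cbv beta.
  transitivity (outer tau p b N * (K N - K (- N)%Z)); [ring|].
  rewrite (odd_part_mod3 K PK). ring.
Qed.

(** A function of [a] times a function of [(p, b)] has vanishing 2 by 2 minors. *)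
Lemma theta_diff_exchange tau p b p' b' a a' : (0 < Im tau)%R ->
  theta_diff tau p b a * theta_diff tau p' b' a' =
  theta_diff tau p' b' a * theta_diff tau p b a'.
Proof.
  intros Ht.
  destruct (theta_diff_has_sum tau a Ht) as [k Hk].
  destruct (theta_diff_has_sum tau a' Ht) as [k' Hk'].
  (* Cross-multiplying compares two sums of the same family, so the common [(p, b)] factor need not
     be shown to converge by itself. *)
  assert (E : forall p b, k' * theta_diff tau p b a = k * theta_diff tau p b a').
  { intros q c. apply has_sum_unique with
      (fun N => k' * (k * (outer tau q c N * chi3 N))).
    - now apply has_sum_scal.
    - apply has_sum_ext with (fun N => k * (k' * (outer tau q c N * chi3 N)));
        [intros; ring | now apply has_sum_scal]. }
  (* If [k = 0], every difference at [a] vanishes and both sides are 0; otherwise the values at [a']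
     are a fixed multiple of those at [a]. *)
  destruct (classic (k = 0)) as [->|Hn].
  - assert (Z : forall p b, theta_diff tau p b a = 0).
    { intros q c.
      apply has_sum_unique with (fun N => 0 * (outer tau q c N * chi3 N)).
      - apply Hk.
      - assert (H := has_sum_scal 0 _ _ (Hk' q c)). rewrite Cmult_0_l in H.
        apply has_sum_ext with (2 := H). intros; ring. }
    rewrite !Z. ring.
  - assert (E' : forall p b,
      theta_diff tau p b a' = / k * k' * theta_diff tau p b a).
    { intros q c. rewrite <- Cmult_assoc, E. field. exact Hn. }
    rewrite !E'. ring.
Qed.

(** * Level five *)

Definition g10 : C := e1 (1 / 10).

Lemma g10_pow5 : g10 ^ 5 = -1.
Proof.
  rewrite <- e1_half. replace (1 / 2)%R
    with (1 / 10 + (1 / 10 + (1 / 10 + (1 / 10 + 1 / 10))))%R by field.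
  rewrite !e1_plus. unfold g10. ring.
Qed.

Lemma zeta5_g10 : zeta5 = g10 ^ 2.
Proof.
  transitivity (e1 (1 / 10 + 1 / 10)).
  - unfold zeta5, e1. f_equal.
    replace (1 / 10 + 1 / 10)%R with (/ 5)%R by field.
    rewrite RtoC_inv by lra. unfold Cdiv. ring.
  - rewrite e1_plus. unfold g10. ring.
Qed.

Lemma e1_3_10 : e1 (3 / 10) = g10 ^ 3.
Proof.
  replace (3 / 10)%R with (1 / 10 + (1 / 10 + 1 / 10))%R by field.
  rewrite !e1_plus. unfold g10. ring.
Qed.

Lemma cthE k tau : cth k tau = thsum tau (1 / 10) (INR k / 10).
Proof.
  unfold cth. rewrite theta_constE. unfold thsum. do 2 f_equal; field.
Qed.

Lemma dthE k tau : dth k tau = thsum tau (3 / 10) (INR k / 10).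
Proof.
  unfold dth. rewrite theta_constE. unfold thsum. do 2 f_equal; field.
Qed.

(** For a tenth root of unity the inverse is the ninth power, so no division appears later. *)
Lemma thsum_unshift (tau : C) (p x : R) : (0 < Im tau)%R -> e1 p ^ 10 = 1 ->
  thsum tau p (x - 1) = e1 p ^ 9 * thsum tau p x.
Proof.
  intros Ht Hp. replace (thsum tau p x) with (thsum tau p (x - 1 + 1))
    by (f_equal; ring).
  rewrite thsum_shift by exact Ht.
  transitivity (e1 p ^ 10 * thsum tau p (x - 1)); [rewrite Hp|]; ring.
Qed.

(** All arguments are odd multiples of 1/10. Those outside the unit interval are moved by one period
    to [k/10] with [k] in 1, 3, 5, 7, 9, at the cost of [w] (down by 1) or [w ^ 9] (up by 1). *)
Lemma theta_diff_level5 (tau : C) (p : R) (S : nat -> C) (w : C) :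
  (0 < Im tau)%R -> (forall k, S k = thsum tau p (INR k / 10)) ->
  w = e1 p -> w ^ 10 = 1 ->
  theta_diff tau p (5 / 10) (- (4 / 10)) =
    S 1%nat ^ 2 * (w * S 3%nat) - S 9%nat ^ 2 * (w ^ 9 * S 7%nat) /\
  theta_diff tau p (5 / 10) (2 / 10) =
    S 7%nat ^ 2 * S 1%nat - S 3%nat ^ 2 * S 9%nat /\
  theta_diff tau p (9 / 10) (- (4 / 10)) =
    S 5%nat ^ 2 * (w * S 7%nat) - (w * S 3%nat) ^ 2 * S 1%nat /\
  theta_diff tau p (9 / 10) (2 / 10) =
    (w * S 1%nat) ^ 2 * S 5%nat - S 7%nat ^ 2 * (w * S 3%nat) /\
  theta_diff tau p (3 / 10) (- (4 / 10)) =
    (w ^ 9 * S 9%nat) ^ 2 * (w * S 1%nat) - S 7%nat ^ 2 * (w ^ 9 * S 5%nat) /\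
  theta_diff tau p (3 / 10) (2 / 10) =
    S 5%nat ^ 2 * (w ^ 9 * S 9%nat) - S 1%nat ^ 2 * S 7%nat /\
  theta_diff tau p (7 / 10) (- (4 / 10)) =
    S 3%nat ^ 2 * (w * S 5%nat) - (w * S 1%nat) ^ 2 * (w ^ 9 * S 9%nat) /\
  theta_diff tau p (7 / 10) (2 / 10) =
    S 9%nat ^ 2 * S 3%nat - S 5%nat ^ 2 * (w * S 1%nat) /\
  theta_diff tau p (1 / 10) (- (4 / 10)) =
    (w ^ 9 * S 7%nat) ^ 2 * S 9%nat - S 5%nat ^ 2 * (w ^ 9 * S 3%nat) /\
  theta_diff tau p (1 / 10) (2 / 10) =
    S 3%nat ^ 2 * (w ^ 9 * S 7%nat) - (w ^ 9 * S 9%nat) ^ 2 * S 5%nat.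
Proof.
  intros Ht HS Hw Hw10. subst w.
  assert (up : forall k, e1 p * S k = thsum tau p (INR k / 10 + 1))
    by (intros k; now rewrite HS, thsum_shift).
  assert (dn : forall k, e1 p ^ 9 * S k = thsum tau p (INR k / 10 - 1))
    by (intros k; now rewrite HS, thsum_unshift).
  rewrite !up, !dn, !HS. unfold theta_diff.
  repeat split; apply (f_equal2 Cminus); apply (f_equal2 Cmult);
    try apply (f_equal (fun t => t ^ 2)); apply (f_equal (thsum tau p));
    simpl INR; field.
Qed.

Theorem theorem8p1 : forall tau : C, (0 < Im tau)%R ->
  let c := fun k => cth k tau in
  let d := fun k => dth k tau in
  let z := zeta5 in
  (c 1%nat ^ 2 * c 3%nat - z ^ 4 * c 9%nat ^ 2 * c 7%nat)
    * (z * d 7%nat ^ 2 * d 1%nat - z * d 3%nat ^ 2 * d 9%nat)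
  = (d 1%nat ^ 2 * d 3%nat - z ^ 2 * d 9%nat ^ 2 * d 7%nat)
    * (z ^ 2 * c 7%nat ^ 2 * c 1%nat - z ^ 2 * c 3%nat ^ 2 * c 9%nat)
  /\
  (z ^ 2 * c 5%nat ^ 2 * c 7%nat + c 3%nat ^ 2 * c 1%nat)
    * (d 1%nat ^ 2 * d 5%nat + z * d 7%nat ^ 2 * d 3%nat)
  = (z * d 5%nat ^ 2 * d 7%nat + d 3%nat ^ 2 * d 1%nat)
    * (c 1%nat ^ 2 * c 5%nat + z ^ 2 * c 7%nat ^ 2 * c 3%nat)
  /\
  (z ^ 2 * c 7%nat ^ 2 * c 5%nat - z ^ 2 * c 9%nat ^ 2 * c 1%nat)
    * (d 1%nat ^ 2 * d 7%nat + z * d 5%nat ^ 2 * d 9%nat)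
  = (z * d 7%nat ^ 2 * d 5%nat - z * d 9%nat ^ 2 * d 1%nat)
    * (c 1%nat ^ 2 * c 7%nat + z ^ 2 * c 5%nat ^ 2 * c 9%nat)
  /\
  (- (c 1%nat ^ 2 * c 9%nat) + c 3%nat ^ 2 * c 5%nat)
    * (z * d 9%nat ^ 2 * d 3%nat + d 5%nat ^ 2 * d 1%nat)
  = (- (d 1%nat ^ 2 * d 9%nat) + d 3%nat ^ 2 * d 5%nat)
    * (z ^ 2 * c 9%nat ^ 2 * c 3%nat + c 5%nat ^ 2 * c 1%nat)
  /\
  (z ^ 2 * c 7%nat ^ 2 * c 9%nat + c 5%nat ^ 2 * c 3%nat)
    * (d 3%nat ^ 2 * d 7%nat + z * d 9%nat ^ 2 * d 5%nat)
  = (z * d 7%nat ^ 2 * d 9%nat + d 5%nat ^ 2 * d 3%nat)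
    * (c 3%nat ^ 2 * c 7%nat + z ^ 2 * c 9%nat ^ 2 * c 5%nat).
Proof.
  intros tau Ht c d z.
  assert (G := g10_pow5).
  assert (G10 : g10 ^ 10 = 1) by ring [G].
  assert (G30 : (g10 ^ 3) ^ 10 = 1) by ring [G].
  destruct (theta_diff_level5 tau (1 / 10) c g10 Ht (fun k => cthE k tau)
    eq_refl G10) as [C1 [C1' [C2 [C2' [C3 [C3' [C4 [C4' [C5 C5']]]]]]]]].
  destruct (theta_diff_level5 tau (3 / 10) d (g10 ^ 3) Ht (fun k => dthE k tau)
    (eq_sym e1_3_10) G30) as [D1 [D1' [D2 [D2' [D3 [D3' [D4 [D4' [D5 D5']]]]]]]]].
  assert (X := fun b => theta_diff_exchange tau (1 / 10) b (3 / 10) b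
    (- (4 / 10)) (2 / 10) Ht).
  assert (X1 := X (5 / 10)%R); rewrite C1, C1', D1, D1' in X1.
  assert (X2 := X (9 / 10)%R); rewrite C2, C2', D2, D2' in X2.
  assert (X3 := X (3 / 10)%R); rewrite C3, C3', D3, D3' in X3.
  assert (X4 := X (7 / 10)%R); rewrite C4, C4', D4, D4' in X4.
  assert (X5 := X (1 / 10)%R); rewrite C5, C5', D5, D5' in X5.
  unfold z. rewrite zeta5_g10.
  clear -G X1 X2 X3 X4 X5.
  (* What remains is polynomial algebra modulo [g ^ 5 = -1]; the power of [g] for each identity
     comes from comparing the coefficients of one monomial. *)
  generalize dependent g10; intros g G X1 X2 X3 X4 X5.
  (* Each goal is the exchange identity up to a power of [g]. *)
  repeat split.
  - match type of X1 with ?L = _ => transitivity (g ^ 1 * L) end;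
      [|rewrite X1]; ring [G].
  - match type of X2 with ?L = _ => transitivity (g ^ 7 * L) end;
      [|rewrite X2]; ring [G].
  - match type of X3 with ?L = _ => transitivity (g ^ 5 * L) end;
      [|rewrite X3]; ring [G].
  - match type of X4 with ?L = _ => transitivity (g ^ 1 * L) end;
      [|rewrite X4]; ring [G].
  - match type of X5 with ?L = _ => transitivity (g ^ 9 * L) end;
      [|rewrite X5]; ring [G].
Qed.
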